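(* Let $\Xi_{GUES}$ be the set of all pairs $(A,B)$ of $2\times 2$ real Hurwitz matrices such that the switched system $$\dot x(t)=u(t)Ax(t)+(1-u(t))Bx(t),\qquad x\in\mathbb{R}^2,\quad u(\cdot):[0,\infty[\to[0,1]\ \text{measurable},$$ is globally uniformly exponentially stable (GUES). For $(A,B)\in\Xi_{GUES}$ let $m(A,B)$ be the minimum of the degrees of the polynomial common Lyapunov functions of the system associated to $(A,B)$. Then $m(A,B)$ is not uniformly bounded over $\Xi_{GUES}$; that is, there is no integer $m$ such that every system in $\Xi_{GUES}$ admits a polynomial common Lyapunov function of degree at most $m$.
   Context: A real matrix is Hurwitz if all its eigenvalues have strictly negative real part. GUES: there exist constants $M,\lambda>0$ such that every solution $x(\cdot)$ of the system, for every measurable $u(\cdot)$ and every initial condition $x(0)=x_0$, satisfies $\|x(t)\|\le Me^{-\lambda t}\|x_0\|$ for all $t>0$. Common Lyapunov function (CLF): a continuous function $V:\mathbb{R}^2\to\mathbb{R}^+$ that is positive definite ($V(0)=0$ and $V(x)>0$ for all $x\neq0$) and strictly decreasing along every nonconstant trajectory of the system (for every measurable $u(\cdot)$). Every GUES system of this type admits a polynomial CLF, so $m(A,B)$ is well defined. *)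

(* Defs.v *)
From HB Require Import structures.
From mathcomp Require Import all_boot all_order all_algebra.
From mathcomp Require Import complex.
From mathcomp Require Import all_classical all_reals all_analysis.
(* not imported: its notations clash with those of mathcomp-analysis *)
From mathcomp Require mpoly.
Import Order.TTheory GRing.Theory Num.Theory.
Import numFieldNormedType.Exports.

Set Implicit Arguments.
Unset Strict Implicit.
Unset Printing Implicit Defensive.

Local Open Scope classical_set_scope.
Local Open Scope ring_scope.

Definition hurwitz (R : realType) (A : 'M[R]_2) : Prop :=
  forall z : complex R,
    eigenvalue (map_mx (fun a : R => Complex a 0) A) z -> complex.Re z < 0.

(* [`|x|] on ['cV[R]_2] is the sup norm *)
Definition enorm (R : realType) (x : 'cV[R]_2) : R :=
  Num.sqrt (\sum_(i < 2) x i ord0 ^+ 2).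

(* [measurable_fun] is Borel measurability. A Lebesgue measurable signal agrees
   almost everywhere with a Borel one, so the trajectories are the same. Values
   at negative times play no role, here and in [trajectory]. *)
Definition switching_signal (R : realType) (u : R -> R) : Prop :=
  measurable_fun (`[0, +oo[ : set R) u /\ (forall t, 0 <= t -> 0 <= u t <= 1).

Definition switched_field (R : realType) (A B : 'M[R]_2) (u : R -> R)
    (t : R) (x : 'cV[R]_2) : 'cV[R]_2 :=
  u t *: (A *m x) + (1 - u t) *: (B *m x).

(* Caratheodory solution of x' = u A x + (1 - u) B x on [0, +oo[: "locally
   absolutely continuous, satisfying the equation almost everywhere" is
   expressed as the integral equation. The integrand is integrable on [0, t]
   because x is continuous and u is measurable with values in [0, 1]. *)
Definition trajectory (R : realType) (A B : 'M[R]_2) (u : R -> R)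
    (x : R -> 'cV[R]_2) : Prop :=
  {within `[0, +oo[, continuous x} /\
  (forall t, 0 <= t -> forall i : 'I_2,
     x t i ord0 = x 0 i ord0
       + \int[lebesgue_measure]_(s in `[0, t])
           (switched_field A B u s (x s) i ord0)).

Definition gues (R : realType) (A B : 'M[R]_2) : Prop :=
  exists M lambda : R, [/\ 0 < M, 0 < lambda &
    forall (u : R -> R) (x : R -> 'cV[R]_2),
      switching_signal u -> trajectory A B u x ->
      forall t, 0 < t -> enorm (x t) <= M * expR (- lambda * t) * enorm (x 0)].

Definition Xi_gues (R : realType) : set ('M[R]_2 * 'M[R]_2) :=
  [set AB | [/\ hurwitz AB.1, hurwitz AB.2 & gues AB.1 AB.2]].

Definition common_lyapunov (R : realType) (A B : 'M[R]_2)
    (V : 'cV[R]_2 -> R) : Prop :=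
  [/\ continuous V,
      forall x, 0 <= V x,
      V 0 = 0,
      forall x, x != 0 -> 0 < V x &
      forall (u : R -> R) (x : R -> 'cV[R]_2),
        switching_signal u -> trajectory A B u x ->
        (exists s t, [/\ 0 <= s, 0 <= t & x s != x t]) ->
        forall s t, 0 <= s -> s < t -> V (x t) < V (x s)].

Definition poly_fun (R : realType) (p : mpoly.mpoly 2 R) (x : 'cV[R]_2) : R :=
  mpoly.meval (fun i : 'I_2 => x i ord0) p.

(* equal to [(msize p).-1]; the notation [msize] needs [mpoly] to be imported *)
Definition total_degree (R : realType) (p : mpoly.mpoly 2 R) : nat :=
  (\max_(m <- mpoly.msupp p) mpoly.mdeg m)%N.

(* Main.v *)
Require Import Defs.
From mathcomp Require Import all_boot all_order all_algebra.
From mathcomp Require Import complex ring lra.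
From mathcomp Require Import all_classical all_reals all_analysis.
From mathcomp Require Import measurable_realfun.
(* Only the canonical instances: the notations clash with mathcomp-analysis. *)
From mathcomp Require Import (canonicals) mpoly.

(* For e > 0 let A_e and B_e be A_0 - e I and B_0 - e I, where A_0 relaxes x_1
   towards x_2 and B_0 relaxes x_2 towards - x_1, the other coordinate being
   frozen. The sup norm does not increase along A_0 and B_0, so it decays like
   exp (- e t) along every trajectory of the e-system, which is therefore GUES
   (a weaker rate is enough below). On the other hand, alternating B_0 and A_0
   moves (r, r) asymptotically to (r, -r), (-r, -r), (-r, r) and back to (r, r).
   If polynomial Lyapunov functions of degree at most m existed for all e, then,
   with coefficients normalized to have sum of absolute values 1, they would
   have a nonzero limit F as e -> 0 (along an ultrafilter) that does not increase
   along A_0 and B_0. Hence F is constant on the boundary of every square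
   [-r, r]^2. Being a polynomial, F is then constant on every vertical and every
   horizontal line, thus F = F 0 = 0, a contradiction. *)

Import Order.TTheory GRing.Theory Num.Theory.
Import numFieldNormedType.Exports.

Set Implicit Arguments.
Unset Strict Implicit.
Unset Printing Implicit Defensive.

Local Open Scope classical_set_scope.
Local Open Scope ring_scope.

(** * The two matrices and their spectra *)

Definition matA (R : realType) (e : R) : 'M[R]_2 :=
  \matrix_(i < 2, j < 2)
    (if i == ord0 then if j == ord0 then - (1 + e) else 1
     else if j == ord0 then 0 else - e).

Definition matB (R : realType) (e : R) : 'M[R]_2 :=
  \matrix_(i < 2, j < 2)
    (if i == ord0 then if j == ord0 then - e else 0
     else if j == ord0 then - 1 else - (1 + e)).

Definition vec2 (R : realType) (a b : R) : 'cV[R]_2 :=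
  \col_(i < 2) (if i == ord0 then a else b).

Lemma ord2P (i : 'I_2) : i = ord0 \/ i = lift ord0 ord0.
Proof. by case: i => [[|[|//]] h]; [left|right]; apply: val_inj. Qed.

Lemma switched_field0 (R : realType) (e : R) u t (x : 'cV[R]_2) :
  switched_field (matA e) (matB e) u t x ord0 ord0 =
  - e * x ord0 ord0 + u t * (x (lift ord0 ord0) ord0 - x ord0 ord0).
Proof. by rewrite !mxE !big_ord_recl !big_ord0 !mxE /=; ring. Qed.

Lemma switched_field1 (R : realType) (e : R) u t (x : 'cV[R]_2) :
  switched_field (matA e) (matB e) u t x (lift ord0 ord0) ord0 =
  - e * x (lift ord0 ord0) ord0
  - (1 - u t) * (x ord0 ord0 + x (lift ord0 ord0) ord0).
Proof. by rewrite !mxE !big_ord_recl !big_ord0 !mxE /=; ring. Qed.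

Lemma complex_Re_lt0 (R : realType) (e : R) (z : complex R) :
  0 < e -> z = Complex (- e) 0 \/ z = Complex (- (1 + e)) 0 -> complex.Re z < 0.
Proof. by move=> e0 [->|->] /=; lra. Qed.

(** The matrix is triangular, so its eigenvalues [- e] and [- (1 + e)] can be read off the entries
    of a left eigenvector. *)
Lemma hurwitzA (R : realType) (e : R) : 0 < e -> hurwitz (matA e).
Proof.
move=> e0 z /eigenvalueP[v /rowP vA vn0]; apply: (complex_Re_lt0 e0).
have := vA ord0; have := vA (lift ord0 ord0).
rewrite !mxE !big_ord_recl !big_ord0 !mxE /= !addr0.
rewrite (_ : Complex 0 0 = 0) // mulr0 addr0.
set a := v ord0 ord0; set b := v _ (lift _ _) => h1 h0.
have [a0|a0] := eqVneq a 0; last first.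
  by right; apply: (mulIf a0); rewrite -h0 mulrC.
have [b0|b0] := eqVneq b 0; last first.
  by left; apply: (mulIf b0); rewrite -h1 a0 mul0r add0r mulrC.
case/negP: vn0; apply/eqP/rowP => i; rewrite mxE.
by case: (ord2P i) => ->.
Qed.

Lemma hurwitzB (R : realType) (e : R) : 0 < e -> hurwitz (matB e).
Proof.
move=> e0 z /eigenvalueP[v /rowP vA vn0]; apply: (complex_Re_lt0 e0).
have := vA ord0; have := vA (lift ord0 ord0).
rewrite !mxE !big_ord_recl !big_ord0 !mxE /= !addr0.
rewrite (_ : Complex 0 0 = 0) // mulr0 add0r.
set a := v ord0 ord0; set b := v _ (lift _ _) => h1 h0.
have [b0|b0] := eqVneq b 0; last first.
  by right; apply: (mulIf b0); rewrite -h1 mulrC.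
have [a0|a0] := eqVneq a 0; last first.
  by left; apply: (mulIf a0); rewrite -h0 b0 mul0r addr0 mulrC.
case/negP: vn0; apply/eqP/rowP => i; rewrite mxE.
by case: (ord2P i) => ->.
Qed.

(** * Polynomials in two real variables *)

(** Coefficients are stored in a matrix of fixed size, so that all polynomials of degree at most [m]
    lie in one finite-dimensional space, where limits can be taken. *)
Definition eval2 (R : realType) (m : nat) (c : 'M[R]_m.+1) (x y : R) : R :=
  \sum_(i < m.+1) \sum_(j < m.+1) c i j * (x ^+ i * y ^+ j).

Lemma poly_fun_eval2 (R : realType) (m : nat) (p : mpoly.mpoly 2 R) :
  (total_degree p <= m)%N ->
  exists c : 'M[R]_m.+1, forall x : 'cV[R]_2,
    poly_fun p x = eval2 c (x ord0 ord0) (x (lift ord0 ord0) ord0).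
Proof.
move=> dp.
pose k (q : mpoly.multinom 2) : 'I_m.+1 * 'I_m.+1 :=
  (inord (mpoly.fun_of_multinom q ord0),
   inord (mpoly.fun_of_multinom q (lift ord0 ord0))).
exists (\sum_(q <- mpoly.msupp p)
  mpoly.mcoeff q p *: delta_mx (k q).1 (k q).2) => x.
rewrite /poly_fun mpoly.mevalE /eval2.
under [RHS]eq_bigr do under eq_bigr do rewrite summxE mulr_suml.
under [RHS]eq_bigr do rewrite exchange_big.
rewrite [RHS]exchange_big /=; apply: eq_big_seq => q qp.
(* Each exponent is at most the total degree, so [inord] in [k] leaves it unchanged. *)
have qm i : (mpoly.fun_of_multinom q i < m.+1)%N.
  rewrite ltnS (leq_trans _ dp)// /total_degree.
  rewrite (leq_trans _ (leq_bigmax_seq _ qp isT))//.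
  by rewrite mpoly.mdegE (bigD1 i)//= leq_addr.
rewrite (bigD1 (k q).1)//= [X in _ + X]big1 ?addr0; last first.
  move=> i iq; apply: big1 => j _.
  by rewrite !mxE (negbTE iq) /= mulr0 mul0r.
rewrite (bigD1 (k q).2)//= [X in _ + X]big1 ?addr0; last first.
  by move=> j jq; rewrite !mxE (negbTE jq) andbF mulr0 mul0r.
rewrite !mxE !eqxx mulr1 !inordK// !big_ord_recl big_ord0 /=.
by rewrite mulr1.
Qed.

(** The difference with [c] vanishes at the distinct points [e / k.+1]; taking as many of them as
    its size forces it to be zero. *)
Lemma sum_pow_eq_const (R : realType) (n : nat) (a : 'I_n.+1 -> R) (c e : R) :
  0 < e -> (forall x, 0 < x <= e -> \sum_(i < n.+1) a i * x ^+ i = c) ->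
  forall i, a i = c *+ (i == ord0).
Proof.
move=> e0 h i.
pose p : {poly R} := \poly_(i < n.+1) a (inord i) - c%:P.
have p0 : p = 0.
  apply/eqP/negPn/negP => pn0.
  pose s := [seq e / k.+1%:R | k <- iota 0 (size p)].
  have := @max_poly_roots _ p s pn0.
  have /[swap] /[apply] : all (root p) s.
    apply/allP => _ /mapP[k _ ->]; apply/rootP.
    rewrite !hornerE horner_poly -(h (e / k.+1%:R)).
      by apply/eqP; rewrite subr_eq0; apply/eqP/eq_bigr => j _; rewrite inord_val.
    rewrite divr_gt0//= ler_pdivrMr// ler_peMr ?ler1n//; exact: ltW.
  rewrite size_map size_iota ltnn => H; suff: false by [].
  apply: H; rewrite map_inj_uniq ?iota_uniq// => k l /(mulfI (lt0r_neq0 e0)).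
  by move/invr_inj/eqP; rewrite eqr_nat => /eqP[].
have : p`_i = 0 by rewrite p0 coef0.
rewrite coefB coefC coef_poly ltn_ord inord_val => /eqP; rewrite subr_eq0.
move=> /eqP ->; rewrite (_ : (i == ord0) = (i == 0%N :> nat)); last by [].
by case: eqP.
Qed.

(** On the side x = r the polynomial does not depend on y, so for j > 0 the coefficient of y^j,
    itself a polynomial in x, vanishes at every r > 0. The top side treats the powers of x likewise,
    and only the constant term, the value at the origin, is left. *)
Lemma eval2_square_const (R : realType) (m : nat) (c : 'M[R]_m.+1) :
  (forall r t : R, 0 < r -> - r <= t <= r -> eval2 c r t = eval2 c r r) ->
  (forall r t : R, 0 < r -> - r <= t <= r -> eval2 c t r = eval2 c r r) ->
  eval2 c 0 0 = 0 -> c = 0.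
Proof.
move=> hy hx h0.
have c_off i j : j != ord0 -> c i j = 0.
  move=> jn0.
  have key x : 0 < x -> \sum_(k < m.+1) c k j * x ^+ k = 0.
    move=> x0; pose a l := \sum_(k < m.+1) c k l * x ^+ k.
    have ha y : 0 < y <= x -> \sum_(l < m.+1) a l * y ^+ l = eval2 c x x.
      move=> /andP[y0 yx]; rewrite -(hy x y x0); last by apply/andP; split; lra.
      rewrite /eval2 exchange_big /=; apply: eq_bigr => k _.
      by rewrite mulr_suml; apply: eq_bigr => l _; rewrite mulrA.
    by have := sum_pow_eq_const x0 ha j; rewrite (negbTE jn0).
  have key1 x : 0 < x <= 1 -> \sum_(k < m.+1) c k j * x ^+ k = 0.
    by move=> /andP[/key].
  by rewrite (sum_pow_eq_const ltr01 key1) mul0rn.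
have c_off' i j : i != ord0 -> c i j = 0.
  move=> in0.
  have key x : 0 < x -> \sum_(k < m.+1) c i k * x ^+ k = 0.
    move=> x0; pose a l := \sum_(k < m.+1) c l k * x ^+ k.
    have ha y : 0 < y <= x -> \sum_(l < m.+1) a l * y ^+ l = eval2 c x x.
      move=> /andP[y0 yx]; rewrite -(hx x y x0); last by apply/andP; split; lra.
      apply: eq_bigr => k _; rewrite mulr_suml; apply: eq_bigr => l _.
      by rewrite mulrAC mulrA.
    by have := sum_pow_eq_const x0 ha i; rewrite (negbTE in0).
  have key1 x : 0 < x <= 1 -> \sum_(k < m.+1) c i k * x ^+ k = 0.
    by move=> /andP[/key].
  by rewrite (sum_pow_eq_const ltr01 key1) mul0rn.
apply/matrixP => i j; rewrite mxE.
have [->|/c_off'//] := eqVneq i ord0.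
have [->|/c_off//] := eqVneq j ord0.
rewrite -h0 /eval2 (bigD1 ord0)//= (bigD1 ord0)//= !expr0 !mulr1.
rewrite big1 ?addr0; last by move=> k /c_off ->; rewrite mul0r.
rewrite big1 ?addr0// => k k0; apply: big1 => l _.
by rewrite c_off'// mul0r.
Qed.

(** * Caratheodory trajectories *)

Lemma continuous_coord (R : realType) (D : set R) (x : R -> 'cV[R]_2) (i : 'I_2) :
  {within D, continuous x} -> {within D, continuous (fun s => x s i ord0 : R)}.
Proof.
move=> cx s.
exact: (@continuous_comp _ _ _ (x : subspace D -> 'cV[R]_2)
  (fun v : 'cV[R]_2 => v i ord0 : R) s (cx s)
  (@coord_continuous R 2 1 i ord0 _)).
Qed.

Lemma subset_itv0y (R : realType) (s t : R) :
  0 <= s -> `[s, t] `<=` `[0, +oo[%classic.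
Proof.
by move=> s0 r /=; rewrite !in_itv /= andbT => /andP[/(le_trans s0)].
Qed.

Lemma integrable_switched_field (R : realType) (A B : 'M[R]_2) (u : R -> R)
    (x : R -> 'cV[R]_2) (i : 'I_2) (t : R) :
  switching_signal u -> {within `[0, +oo[, continuous x} ->
  lebesgue_measure.-integrable (`[0, t] : set R)
    (EFin \o (fun s => switched_field A B u s (x s) i ord0)).
Proof.
move=> [mu u01] cx.
have cx' : {within `[0, t], continuous x}.
  by apply: continuous_subspaceW cx; exact: subset_itv0y.
have cM (C : 'M[R]_2) : {within `[0, t], continuous (fun s => (C *m x s) i ord0 : R)}.
  have -> : (fun s => (C *m x s) i ord0) = (fun s => C i ord0 * x s ord0 ord0
      + C i (lift ord0 ord0) * x s (lift ord0 ord0) ord0).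
    by apply/funext => s; rewrite !mxE !big_ord_recl big_ord0 addr0.
  move=> s; apply: cvgD; apply: cvgMr; exact: (continuous_coord cx').
have bM (C : 'M[R]_2) : exists M : R, forall s, `[0, t]%classic s ->
    `|(C *m x s) i ord0 : R| <= M.
  have /compact_bounded[M [_ hM]] :=
    continuous_compact (cM C) (@segment_compact _ 0 t).
  exists (M + 1) => s st; apply: (hM (M + 1)); first by rewrite ltrDl.
  by exists s.
apply: measurable_bounded_integrable => //.
- by rewrite /= lebesgue_measure_itv /=; case: ifP; rewrite ?ltry.
- have mC (C : 'M[R]_2) : measurable_fun (`[0, t] : set R)
      (fun s => (C *m x s) i ord0 : R).
    by apply: subspace_continuous_measurable_fun; [exact: measurable_itv|exact: cM].
  have mu' : measurable_fun (`[0, t] : set R) u.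
    by apply: measurable_funS mu => //; exact: subset_itv0y.
  rewrite (_ : (fun s => _) =
    (u \* (fun s => (A *m x s) i ord0)) \+
    ((cst 1 \- u) \* (fun s => (B *m x s) i ord0))); last first.
    by apply/funext => s; rewrite /switched_field mxE [X in X + _]mxE [X in _ + X]mxE.
  by apply: measurable_funD; apply: measurable_funM => //;
    [exact: mC|apply: measurable_funB => //; exact: measurable_cst|exact: mC].
- have [MA hA] := bM A; have [MB hB] := bM B.
  exists (MA + MB); split; first exact: num_real.
  move=> M' /ltW hM' s /= st; apply: le_trans hM'.
  have := hA _ st; have := hB _ st.
  have /andP[u0 u1] : 0 <= u s <= 1.
    by apply: u01; move: st; rewrite /= in_itv /= => /andP[].
  rewrite !mxE.
  set a := \sum_j _; set b := \sum_j _ => hb ha.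
  apply: le_trans (ler_normD _ _) _; rewrite !normrM; apply: lerD.
    by apply: le_trans ha; rewrite ger0_norm// ler_piMl.
  by apply: le_trans hb; rewrite ger0_norm ?subr_ge0// ler_piMl// lerBlDr lerDl.
Qed.

(** A mean value inequality for trajectories that need not be differentiable: the bounds are
    integrated over []s, t]]. *)
Lemma trajectory_mean_bound (R : realType) (A B : 'M[R]_2) (u : R -> R)
    (x : R -> 'cV[R]_2) (i : 'I_2) (s t a b : R) :
  switching_signal u -> trajectory A B u x -> 0 <= s -> s <= t ->
  (forall r, s <= r <= t -> a <= switched_field A B u r (x r) i ord0 <= b) ->
  a * (t - s) <= x t i ord0 - x s i ord0 <= b * (t - s).
Proof.
move=> hu [cx hx] s0 st hab.
have t0 := le_trans s0 st.
rewrite (hx t t0 i) (hx s s0 i) opprD addrACA subrr add0r.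
have it := integrable_switched_field A B i t hu cx.
rewrite Rintegral_itvB//.
have it' : lebesgue_measure.-integrable (`]s, t] : set R)
    (EFin \o (fun s => switched_field A B u s (x s) i ord0)).
  apply: integrableS it => //; apply: subset_itvr.
  by rewrite bnd_simp.
have st' r : `]s, t]%classic r -> s <= r <= t.
  by rewrite /= in_itv /= => /andP[/ltW -> ->].
have ic c : lebesgue_measure.-integrable (`]s, t] : set R) (EFin \o (cst c : R -> R)).
  apply: measurable_bounded_integrable => //.
    by rewrite /= lebesgue_measure_itv /=; case: ifP; rewrite ?ltry.
  by exists `|c|; split; [exact: num_real|move=> M /ltW cM r _].
have Ec c : \int[lebesgue_measure]_(r in `]s, t]) (cst c r) = c * (t - s) :> R.
  rewrite /cst Rintegral_cst//= lebesgue_measure_itv /= lte_fin.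
  move: st; rewrite le_eqVlt => /orP[/eqP ->|->//]; first by rewrite ltxx subrr.
rewrite -(Ec a) -(Ec b); apply/andP; split; apply: le_Rintegral => // r /st' /hab.
  by case/andP.
by case/andP.
Qed.

(** * Exponential stability *)

Definition supn (R : realType) (x : 'cV[R]_2) : R :=
  Num.max `|x ord0 ord0| `|x (lift ord0 ord0) ord0|.

Lemma coord_le_supn (R : realType) (x : 'cV[R]_2) i : `|x i ord0| <= supn x.
Proof. by rewrite /supn le_max; case: (ord2P i) => ->; rewrite lexx ?orbT. Qed.

Lemma supn_leP (R : realType) (x : 'cV[R]_2) a :
  (forall i, `|x i ord0| <= a) -> supn x <= a.
Proof. by move=> h; rewrite /supn ge_max !h. Qed.

(* Each coordinate y of the state obeys y' = - e y + v (z - y), where z is plus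
   or minus the other coordinate and v is u or 1 - u. *)
Lemma relaxation_bound (R : realType) (e N d v y y0 z : R) :
  0 <= e -> 0 <= v <= 1 -> `|y - y0| <= d -> `|z| <= N + d -> `|y0| <= N ->
  - ((1 + e) * y0) - (N + (e + 2) * d) <= - e * y + v * (z - y)
    <= - ((1 + e) * y0) + (N + (e + 2) * d).
Proof.
move=> e0 /andP[v0 v1] /ler_normlP[h1 h2] /ler_normlP[h3 h4] /ler_normlP[h5 h6].
by apply/andP; split; nra.
Qed.

(** The bounds depend on the reference state [x0] but not on [u], so they integrate as constants;
    [(e + 2) * d] pays for replacing [x] by [x0]. With [x0 = 0] and [N = 0] this is the crude speed
    bound [(e + 2) * d]. *)
Lemma switched_field_supn (R : realType) (e N d : R) (u : R -> R) r
    (x x0 : 'cV[R]_2) i :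
  0 <= e -> 0 <= u r <= 1 -> (forall j, `|x j ord0 - x0 j ord0| <= d) ->
  supn x0 <= N ->
  - ((1 + e) * x0 i ord0) - (N + (e + 2) * d)
    <= switched_field (matA e) (matB e) u r x i ord0
    <= - ((1 + e) * x0 i ord0) + (N + (e + 2) * d).
Proof.
move=> e0 u01 hd x0N.
have x0j j : `|x0 j ord0| <= N by apply: le_trans x0N; exact: coord_le_supn.
have hx j : `|x j ord0| <= N + d.
  rewrite -[x j ord0](subrK (x0 j ord0)) addrC.
  by apply: le_trans (ler_normD _ _) _; rewrite lerD.
case: (ord2P i) => ->.
  by rewrite switched_field0; apply: relaxation_bound.
rewrite switched_field1.
rewrite [- _ * _ - _](_ : _ = - e * x (lift ord0 ord0) ord0 +
  (1 - u r) * (- x ord0 ord0 - x (lift ord0 ord0) ord0)); last by ring.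
by apply: relaxation_bound => //; rewrite ?normrN//; case/andP: u01 => ? ?;
  apply/andP; split; lra.
Qed.

Lemma continuous_supn (R : realType) (D : set R) (x : R -> 'cV[R]_2) :
  {within D, continuous x} -> {within D, continuous (fun s => supn (x s))}.
Proof.
move=> cx s; rewrite /supn.
have h i : {within D, continuous (fun s => `|x s i ord0| : R)}.
  by move=> r; apply: cvg_norm; exact: (continuous_coord cx).
exact: (continuous_max (h ord0 s) (h (lift ord0 ord0) s)).
Qed.

(* Freezing the state at time s costs an error of order h^2, which half of the
   decay e h absorbs. *)
Lemma supn_step (R : realType) (e : R) (u : R -> R) (x : R -> 'cV[R]_2) (s h : R) :
  0 < e -> switching_signal u -> trajectory (matA e) (matB e) u x ->
  0 <= s -> 0 <= h -> 4 * (e + 2) ^+ 2 * h <= e ->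
  supn (x (s + h)) <= (1 - e * h / 2) * supn (x s).
Proof.
move=> e0 hu hx s0 h0 he.
have hesmall : (e + 2) * h <= 1 / 4 by nra.
set N := supn (x s); have N0 : 0 <= N by rewrite /N /supn le_max normr_ge0.
have sh : s <= s + h by rewrite lerDl.
(* The largest sup norm [S] over the step bounds the speed by [(e + 2) * S], hence the distance to
   the state at time [s]. *)
have [c cst cmax] : exists2 c, c \in `[s, s + h] &
    forall t, t \in `[s, s + h] -> supn (x t) <= supn (x c).
  apply: EVT_max => //; apply: continuous_supn.
  by apply: continuous_subspaceW hx.1; exact: subset_itv0y.
set S := supn (x c).
have S0 : 0 <= S by rewrite /S /supn le_max normr_ge0.
have u01 r : s <= r -> 0 <= u r <= 1 by move=> sr; apply: hu.2; exact: le_trans sr.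
have dist r j : s <= r <= s + h -> `|x r j ord0 - x s j ord0| <= (e + 2) * S * h.
  move=> /andP[sr rh].
  have : - ((e + 2) * S) * (r - s) <= x r j ord0 - x s j ord0 <= (e + 2) * S * (r - s).
    apply: (trajectory_mean_bound hu hx s0 sr) => q /andP[sq qr].
    have := @switched_field_supn R e 0 S u q (x q) 0 j (ltW e0) (u01 q sq).
    rewrite !mxE mulr0 oppr0 sub0r !add0r; apply.
      move=> k; rewrite mxE subr0; apply: le_trans (coord_le_supn _ _) _.
      by apply: cmax; rewrite in_itv /= sq (le_trans qr).
    by apply: supn_leP => k; rewrite mxE normr0.
  have hr : (e + 2) * S * (r - s) <= (e + 2) * S * h.
    by rewrite ler_wpM2l ?mulr_ge0 ?addr_ge0// ?(ltW e0)// lerBlDl.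
  by move=> /andP[h1 h2]; apply/ler_normlP; split; lra.
(* The maximum exceeds [N] by at most [(e + 2) * S * h], a quarter of [S]. *)
have SN : S <= 2 * N.
  suff : S <= N + (e + 2) * S * h by nra.
  apply: supn_leP => j; rewrite -[x c j ord0](subrK (x s j ord0)) addrC.
  apply: le_trans (ler_normD _ _) _; apply: lerD; first exact: coord_le_supn.
  by apply: dist; move: cst; rewrite in_itv.
apply: supn_leP => i.
(* By [dist] and [SN], the state stays within [d = 2 * (e + 2) * h * N] of the one at time [s]. *)
have : (- ((1 + e) * x s i ord0) - (N + (e + 2) * (2 * (e + 2) * h * N))) * (s + h - s)
    <= x (s + h) i ord0 - x s i ord0 <=
  (- ((1 + e) * x s i ord0) + (N + (e + 2) * (2 * (e + 2) * h * N))) * (s + h - s).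
  apply: (trajectory_mean_bound hu hx s0 sh) => r /andP[sr rh].
  apply: switched_field_supn => //; [exact: ltW|exact: u01|].
  move=> j; apply: le_trans (dist r j _) _; first by rewrite sr.
  rewrite mulrAC (_ : 2 * _ * h * N = (e + 2) * h * (2 * N)); last by ring.
  by rewrite ler_wpM2l// mulr_ge0// addr_ge0// ltW.
have /ler_normlP := coord_le_supn (x s) i; rewrite -/N => -[xN1 xN2].
rewrite addrAC subrr add0r => /andP[h1 h2].
(* With a nonnegative factor on [x s i ord0], the main terms add up to at most [(1 - (1 + e) * h) *
   N + h * N = (1 - e * h) * N]; the error [k2] gives back half of the gain. *)
have k1 : 0 <= 1 - (1 + e) * h by nra.
have k2 : 2 * (e + 2) ^+ 2 * h ^+ 2 * N <= e * h / 2 * N.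
  rewrite [leLHS](_ : _ = 4 * (e + 2) ^+ 2 * h * (h * N / 2)); last by field.
  rewrite [leRHS](_ : _ = e * (h * N / 2)); last by field.
  by rewrite ler_wpM2r// divr_ge0// mulr_ge0.
have k3 : (1 - (1 + e) * h) * x s i ord0 <= (1 - (1 + e) * h) * N by rewrite ler_wpM2l.
have k4 : (1 - (1 + e) * h) * - x s i ord0 <= (1 - (1 + e) * h) * N by rewrite ler_wpM2l.
by apply/ler_normlP; split; lra.
Qed.

(** Cut [[0, t]] into [n] equal steps and use [1 - e * h / 2 <= expR (- (e / 2) * h)] on each. *)
Lemma supn_decay (R : realType) (e : R) (u : R -> R) (x : R -> 'cV[R]_2) (t : R) :
  0 < e -> switching_signal u -> trajectory (matA e) (matB e) u x -> 0 <= t ->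
  supn (x t) <= expR (- (e / 2) * t) * supn (x 0).
Proof.
move=> e0 hu hx t0.
(* Any [n >= q] makes [h = t / n] small enough for [supn_step]; the successor keeps [n] nonzero when
   [t = 0]. *)
pose q := 4 * (e + 2) ^+ 2 * t / e.
have q0 : 0 <= q by rewrite /q divr_ge0 ?(ltW e0)// mulr_ge0// mulr_ge0// sqr_ge0.
pose n := (Num.truncn q).+1.
have qn : q <= n%:R by apply/ltW/truncnS_gt.
pose h := t / n%:R.
have h0 : 0 <= h by rewrite divr_ge0.
have he : 4 * (e + 2) ^+ 2 * h <= e.
  rewrite /h mulrA ler_pdivrMr ?ltr0n// mulrC.
  by move: qn; rewrite /q ler_pdivrMr// mulrC [X in _ <= X -> _]mulrC.
have N0 : 0 <= supn (x 0) by rewrite /supn le_max normr_ge0.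
have iter k : supn (x (h * k%:R)) <= expR (- (e / 2) * (h * k%:R)) * supn (x 0).
  elim: k => [|k IH]; first by rewrite !mulr0 expR0 mul1r.
  rewrite -natr1 mulrDr mulr1 mulrDr expRD.
  apply: le_trans (supn_step e0 hu hx _ h0 he) _; first by rewrite mulr_ge0.
  have ge1 := expR_ge1Dx (- (e / 2) * h).
  rewrite [leRHS]mulrAC [leRHS]mulrC; apply: ler_pM => //.
  - have : (e + 2) * h <= 1 / 4 by nra.
    nra.
  - by rewrite /supn le_max normr_ge0.
  - by apply: le_trans ge1; lra.
have := iter n; rewrite /h divfK//.
by rewrite pnatr_eq0.
Qed.

Lemma gues_AB (R : realType) (e : R) : 0 < e -> gues (matA e) (matB e).
Proof.
(* The factor 2 compares the Euclidean norm with the sup norm, and [e / 2] is the rate in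
   [supn_decay]. *)
move=> e0; exists 2, (e / 2); split; rewrite ?divr_gt0// => u x hu hx t t0.
have e_le (y : 'cV[R]_2) : enorm y <= 2 * supn y.
  have N0 : 0 <= supn y by rewrite /supn le_max normr_ge0.
  rewrite /enorm -(ger0_norm (mulr_ge0 _ N0))// -sqrtr_sqr ler_sqrt ?sqr_ge0//.
  rewrite !big_ord_recl big_ord0 addr0.
  have h i : y i ord0 ^+ 2 <= supn y ^+ 2.
    by rewrite -(real_normK (num_real _)) lerXn2r ?nnegrE// coord_le_supn.
  have := h ord0; have := h (lift ord0 ord0); nra.
have le_e (y : 'cV[R]_2) : supn y <= enorm y.
  apply: supn_leP => i; rewrite -sqrtr_sqr ler_sqrt ?sumr_ge0// => [|j _].
    by rewrite (bigD1 i)//= lerDl sumr_ge0// => j _; exact: sqr_ge0.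
  exact: sqr_ge0.
apply: (le_trans (e_le (x t))); rewrite -mulrA ler_pM2l//.
apply: le_trans (supn_decay e0 hu hx (ltW t0)) _.
by rewrite ler_pM2l ?expR_gt0.
Qed.

(** * Explicit trajectories *)

Lemma Rintegral_derivative (R : realType) (F f : R -> R) (t : R) :
  (forall s : R, is_derive s 1 F (f s)) -> continuous f -> 0 <= t ->
  F t = F 0 + \int[lebesgue_measure]_(s in `[0, t]) f s.
Proof.
move=> dF cf; rewrite le_eqVlt => /predU1P[<-|t0].
  by rewrite set_itv1 Rintegral_set1 addr0.
have cF s : F x @[x --> s] --> F s.
  by apply: differentiable_continuous; apply/derivable1_diffP; case: (dF s).
rewrite /Rintegral (@continuous_FTC2 _ f F) //=.
- ring.
- exact: continuous_subspaceT.
- split=> [s _||]; first by case: (dF s).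
  + by apply: cvg_at_right_filter; exact: cF.
  + by apply: cvg_at_left_filter; exact: cF.
- by move=> s _; rewrite derive1E; case: (dF s).
Qed.

(** A combination of the two exponential modes shared by [matA e] and [matB e]; differentiation only
    rescales [p] and [q]. *)
Definition exp2 (R : realType) (e p q s : R) : R :=
  p * expR (- e * s) + q * expR (- (1 + e) * s).

Lemma is_derive_exp2 (R : realType) (e p q s : R) :
  is_derive s 1 (exp2 e p q) (exp2 e (- e * p) (- (1 + e) * q) s).
Proof.
have dE (k : R) : is_derive s 1 (fun x => expR (k * x)) (k * expR (k * s)).
  have dk : is_derive s 1 (fun x => k * x) k.
    by apply: is_derive_eq; rewrite scaler1.
  have := is_derive1_comp (is_derive_expR (k * s)) dk.
  by rewrite mulrC.
have := is_deriveD (is_deriveZ p (dE (- e))) (is_deriveZ q (dE (- (1 + e)))).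
by rewrite /exp2 /GRing.scale /= !mulrA ![_ * - _]mulrC.
Qed.

Lemma continuous_exp2 (R : realType) (e p q : R) : continuous (exp2 e p q).
Proof.
move=> s; apply: differentiable_continuous; apply/derivable1_diffP.
by case: (is_derive_exp2 e p q s).
Qed.

Lemma exp2_0 (R : realType) (e p q : R) : exp2 e p q 0 = p + q.
Proof. by rewrite /exp2 !mulr0 expR0 !mulr1. Qed.

Lemma trajectory_exp2 (R : realType) (A B : 'M[R]_2) (u : R -> R)
    (e p q p' q' : R) :
  (forall s, switched_field A B u s (vec2 (exp2 e p q s) (exp2 e p' q' s)) =
    vec2 (exp2 e (- e * p) (- (1 + e) * q) s)
         (exp2 e (- e * p') (- (1 + e) * q') s)) ->
  trajectory A B u (fun s => vec2 (exp2 e p q s) (exp2 e p' q' s)).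
Proof.
move=> h; split.
  apply: continuous_subspaceT => s.
  rewrite (_ : (fun s => _) = (fun s => exp2 e p q s *: vec2 1 0 +
      exp2 e p' q' s *: vec2 0 1)); last first.
    apply/funext => r; apply/matrixP => i j; rewrite !mxE.
    by case: ifP => _; rewrite ?mulr0 ?mulr1 ?addr0 ?add0r.
  by apply: cvgD; apply: cvgZr_tmp; exact: continuous_exp2.
move=> t t0 i; under eq_Rintegral do rewrite h.
case: (ord2P i) => ->; rewrite /vec2 !mxE /=; under eq_Rintegral do rewrite mxE /=;
  by apply: Rintegral_derivative => // [s|]; [exact: is_derive_exp2|
    exact: continuous_exp2].
Qed.

Lemma switching_signal_cst (R : realType) (c : R) :
  0 <= c <= 1 -> switching_signal (cst c).
Proof. by move=> c01; split=> // t _. Qed.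

(** The start is [(a, b)]. Up to the factor [expR (- e * s)], the second coordinate is frozen and
    the gap [a - b] shrinks like [expR (- s)]. *)
Lemma trajectoryA (R : realType) (e a b : R) :
  trajectory (matA e) (matB e) (cst 1)
    (fun s => vec2 (exp2 e b (a - b) s) (exp2 e b 0 s)).
Proof.
apply: trajectory_exp2 => s; apply/matrixP => i j; rewrite (ord1 j).
case: (ord2P i) => ->; rewrite ?(switched_field0, switched_field1) !mxE /= /exp2; ring.
Qed.

(** Again from [(a, b)]: up to the same factor, the first coordinate is frozen and the second tends
    to [- a]. *)
Lemma trajectoryB (R : realType) (e a b : R) :
  trajectory (matA e) (matB e) (cst 0)
    (fun s => vec2 (exp2 e a 0 s) (exp2 e (- a) (a + b) s)).
Proof.
apply: trajectory_exp2 => s; apply/matrixP => i j; rewrite (ord1 j).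
case: (ord2P i) => ->; rewrite ?(switched_field0, switched_field1) !mxE /= /exp2; ring.
Qed.

(** Strict decrease is granted only on nonconstant trajectories, so the case [x t = x 0] is split
    off. *)
Lemma common_lyapunov_le (R : realType) (A B : 'M[R]_2) V u x (t : R) :
  common_lyapunov A B V -> switching_signal u -> trajectory A B u x ->
  0 <= t -> V (x t) <= V (x 0).
Proof.
move=> [_ _ _ _ hV] hu hx t0; have [->//|xt] := eqVneq (x t) (x 0).
move: t0; rewrite le_eqVlt => /predU1P[<-//|t0].
by apply/ltW/(hV _ _ hu hx) => //; exists t, 0; split=> //; exact: ltW.
Qed.

(** * Limits of Lyapunov polynomials *)

Lemma cvg_eval2 (R : realType) (m : nat) (F : set_system nat) {FF : Filter F}
    (c : nat -> 'M[R]_m.+1) (l : 'M[R]_m.+1) (f g : nat -> R) (a b : R) :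
  (forall i j, c n i j @[n --> F] --> l i j) ->
  f @ F --> a -> g @ F --> b ->
  eval2 (c n) (f n) (g n) @[n --> F] --> eval2 l a b.
Proof.
move=> hc hf hg.
have hX (h : nat -> R) (d : R) k : h @ F --> d -> h n ^+ k @[n --> F] --> d ^+ k.
  by move=> hd; exact: (cvg_comp _ _ hd (@exprn_continuous R k d)).
apply: cvg_big => [|i _]; first exact: add_continuous.
apply: cvg_big => [|j _]; first exact: add_continuous.
by apply: cvgM; [exact: hc|apply: cvgM; exact: hX].
Qed.

(** This carries the normalization over to the limit, which is therefore nonzero. *)
Lemma cvg_sum_norm (R : realType) (m : nat) (F : set_system nat) {FF : Filter F}
    (c : nat -> 'M[R]_m.+1) (l : 'M[R]_m.+1) :
  (forall i j, c n i j @[n --> F] --> l i j) ->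
  \sum_(i < m.+1) \sum_(j < m.+1) `|c n i j| @[n --> F] -->
  \sum_(i < m.+1) \sum_(j < m.+1) `|l i j|.
Proof.
move=> hc; apply: cvg_big => [|i _]; first exact: add_continuous.
apply: cvg_big => [|j _]; first exact: add_continuous.
exact: cvg_norm (hc i j).
Qed.

(** The parameter [s] stands for exp(-t) along the flows with e = 0, and [s = 0] for their endpoints
    at infinite time. Going once around the square, the values decrease weakly and return to the
    start, so they are all equal. *)
Lemma flow_invariant_eq0 (R : realType) (m : nat) (c : 'M[R]_m.+1) :
  (forall a b s, 0 <= s <= 1 -> eval2 c (b + (a - b) * s) b <= eval2 c a b) ->
  (forall a b s, 0 <= s <= 1 -> eval2 c a (- a + (a + b) * s) <= eval2 c a b) ->
  eval2 c 0 0 = 0 -> c = 0.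
Proof.
move=> hA hB.
have hA0 a b : eval2 c b b <= eval2 c a b.
  by have := hA a b 0; rewrite mulr0 addr0 lexx ler01; exact.
have hB0 a b : eval2 c a (- a) <= eval2 c a b.
  by have := hB a b 0; rewrite mulr0 addr0 lexx ler01; exact.
(* The flow of B_0 from [(r, r)] sweeps the right side, and below that of A_0 from [(- r, r)] sweeps
   the top; the witnesses solve for [s] at the given point. *)
have left_le r t : 0 < r -> - r <= t <= r -> eval2 c r t <= eval2 c r r.
  move=> r0 /andP[h1 h2]; have := hB r r ((t + r) / (2 * r)).
  rewrite (_ : - r + (r + r) * ((t + r) / (2 * r)) = t); last by field; rewrite lt0r_neq0.
  apply; rewrite divr_ge0 ?ler_pdivrMr; lra.
have top_le r t : 0 < r -> - r <= t <= r -> eval2 c t r <= eval2 c (- r) r.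
  move=> r0 /andP[h1 h2]; have := hA (- r) r ((r - t) / (2 * r)).
  rewrite (_ : r + (- r - r) * ((r - t) / (2 * r)) = t); last by field; rewrite lt0r_neq0.
  apply; rewrite divr_ge0 ?ler_pdivrMr; lra.
have corner1 r : eval2 c (- r) (- r) <= eval2 c r (- r) by exact: hA0.
have corner2 r : eval2 c (- r) r <= eval2 c (- r) (- r).
  by have := hB0 (- r) (- r); rewrite opprK.
(* The cycle of corners is [(r, r)], [(r, - r)], [(- r, - r)], [(- r, r)], [(r, r)]. *)
apply: eval2_square_const => r t r0 rt; apply/eqP; rewrite eq_le.
- rewrite left_le//= (le_trans _ (hB0 r t))// (le_trans _ (corner1 r))//.
  by rewrite (le_trans _ (corner2 r))// (le_trans _ (top_le r r r0 _))//; lra.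
- rewrite hA0 andbT (le_trans (top_le r t r0 rt))// (le_trans (corner2 r))//.
  by rewrite (le_trans (corner1 r))// left_le//; lra.
Qed.

(** Division by the sum of absolute values preserves the inequalities and puts the coefficients into
    a compact set independent of [e]. *)
Lemma normalized_coefficients (R : realType) (m : nat) (e : R)
    (p : mpoly.mpoly 2 R) :
  common_lyapunov (matA e) (matB e) (poly_fun p) -> (total_degree p <= m)%N ->
  exists c : 'M[R]_m.+1,
  [/\ \sum_(i < m.+1) \sum_(j < m.+1) `|c i j| = 1,
      eval2 c 0 0 = 0,
      forall a b t : R, 0 <= t ->
        eval2 c (exp2 e b (a - b) t) (exp2 e b 0 t) <= eval2 c a b &
      forall a b t : R, 0 <= t ->
        eval2 c (exp2 e a 0 t) (exp2 e (- a) (a + b) t) <= eval2 c a b].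
Proof.
move=> hp /poly_fun_eval2[c hc].
have hc' (a b : R) : poly_fun p (vec2 a b) = eval2 c a b by rewrite hc !mxE.
pose s := \sum_(i < m.+1) \sum_(j < m.+1) `|c i j|.
have s_ge0 : 0 <= s by apply: sumr_ge0 => i _; apply: sumr_ge0.
have [_ _ p0 ppos _] := hp.
(* If all coefficients vanished, so would the polynomial at [(1, 1)], against positive
   definiteness. *)
have s_gt0 : 0 < s.
  rewrite lt_neqAle s_ge0 andbT eq_sym; apply/eqP => s0.
  have c0 i j : c i j = 0.
    have := s0; rewrite /s => /eqP; rewrite psumr_eq0; last first.
      by move=> k _; apply: sumr_ge0.
    move=> /allP /(_ i (mem_index_enum _)) /=.
    rewrite psumr_eq0// => /allP /(_ j (mem_index_enum _)) /=.
    by rewrite normr_eq0 => /eqP.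
  have := ppos (vec2 1 1); rewrite hc' /eval2 big1 ?ltxx; last first.
    by move=> i _; apply: big1 => j _; rewrite c0 mul0r.
  suff h : vec2 1 1 != 0 :> 'cV[R]_2 by move/(_ h).
  apply/eqP => /matrixP /(_ ord0 ord0); rewrite !mxE => /eqP.
  by rewrite oner_eq0.
have ev (a b : R) : eval2 (s^-1 *: c) a b = s^-1 * eval2 c a b.
  rewrite /eval2 mulr_sumr; apply: eq_bigr => i _.
  by rewrite mulr_sumr; apply: eq_bigr => j _; rewrite mxE -mulrA.
have sV : 0 < s^-1 by rewrite invr_gt0.
exists (s^-1 *: c); split.
- transitivity (s^-1 * s); last by rewrite mulVf// lt0r_neq0.
  rewrite [in RHS]/s mulr_sumr; apply: eq_bigr => i _.
  by rewrite mulr_sumr; apply: eq_bigr => j _; rewrite mxE normrM gtr0_norm.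
- rewrite ev -hc' (_ : vec2 0 0 = 0) ?p0 ?mulr0//.
  by apply/matrixP => i j; rewrite !mxE; case: ifP.
- move=> a b t t0; rewrite !ev ler_pM2l// -!hc'.
  have hu : switching_signal (cst 1 : R -> R).
    by apply: switching_signal_cst; rewrite ler01 lexx.
  have := common_lyapunov_le hp hu (trajectoryA e a b) t0.
  by rewrite /= !exp2_0 addr0 (_ : b + (a - b) = a)//; ring.
- move=> a b t t0; rewrite !ev ler_pM2l// -!hc'.
  have hu : switching_signal (cst 0 : R -> R).
    by apply: switching_signal_cst; rewrite ler01 lexx.
  have := common_lyapunov_le hp hu (trajectoryB e a b) t0.
  by rewrite /= !exp2_0 addr0 addKr.
Qed.

Lemma cvg_exp2 (R : realType) (F : set_system nat) {FF : Filter F}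
    (e : nat -> R) (p q t : R) :
  e @ F --> (0 : R) -> exp2 (e n) p q t @[n --> F] --> p + q * expR (- t).
Proof.
move=> he.
have hE (k : R) : expR (- (k + e n) * t) @[n --> F] --> expR (- k * t).
  suff hN : - (k + e n) * t @[n --> F] --> - k * t.
    exact: (cvg_comp _ _ hN (@continuous_expR R _)).
  apply: cvgM; last exact: cvg_cst.
  apply: cvgN; rewrite -[X in _ --> X]addr0.
  by apply: cvgD => //; exact: cvg_cst.
rewrite /exp2; apply: cvgD.
  rewrite -[X in _ --> X]mulr1; apply: cvgMr.
  have := hE 0; rewrite oppr0 mul0r expR0.
  by under eq_fun do rewrite add0r.
by rewrite -[- t]mulN1r; apply: cvgMr; exact: hE.
Qed.

Lemma ultra_fmap (T T' : Type) (f : T -> T') (F : set_system T) :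
  UltraFilter F -> UltraFilter (fmap f F).
Proof.
move=> UF; split; first exact: fmap_proper_filter.
move=> G PG FG; apply/seteqP; split=> // A GA.
have [//|FCA] := in_ultra_setVsetC (f @^-1` A) UF.
have /FG GCA : fmap f F (~` A) by [].
exfalso; apply: (@filter_not_empty _ G PG).
by rewrite -(setICr A); exact: filterI.
Qed.

Theorem theorem2 (R : realType) :
  ~ (exists m : nat,
       forall A B : 'M[R]_2, Xi_gues (A, B) ->
         exists p : mpoly.mpoly 2 R,
           common_lyapunov A B (poly_fun p) /\ (total_degree p <= m)%N).
Proof.
move=> [m hm].
pose e (n : nat) : R := n.+1%:R^-1.
have e_gt0 n : 0 < e n by rewrite invr_gt0.
have : forall n, exists c : 'M[R]_m.+1,
  [/\ \sum_(i < m.+1) \sum_(j < m.+1) `|c i j| = 1,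
      eval2 c 0 0 = 0,
      forall a b t : R, 0 <= t -> eval2 c (exp2 (e n) b (a - b) t)
        (exp2 (e n) b 0 t) <= eval2 c a b &
      forall a b t : R, 0 <= t -> eval2 c (exp2 (e n) a 0 t)
        (exp2 (e n) (- a) (a + b) t) <= eval2 c a b].
  move=> n; have [|p [hp dp]] := hm (matA (e n)) (matB (e n)).
    by split; [exact: hurwitzA|exact: hurwitzB|exact: gues_AB].
  exact: normalized_coefficients hp dp.
move=> /choice[c hc].
(* Along an ultrafilter finer than [\oo], every coefficient converges, since it stays in the compact
   [[-1, 1]]; no subsequence has to be extracted. *)
have [U [UU hU]] := @ultraFilterLemma nat \oo _.
have PU : ProperFilter U by exact: ultra_proper.
have FU : Filter U by typeclasses eauto.
have eU : e @ U --> (0 : R).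
  by apply: cvg_trans (cvg_app e hU) _; exact: cvg_harmonic.
have : forall ij : 'I_m.+1 * 'I_m.+1, exists l : R, c n ij.1 ij.2 @[n --> U] --> l.
  move=> [i j].
  have cI : (fmap (fun n => c n i j) U) `[-1, 1]%classic.
    apply: (@filterE nat U) => n; rewrite /= in_itv /= -ler_norml.
    have [<- _ _ _] := hc n.
    rewrite (bigD1 i)//= (bigD1 j)//= -addrA lerDl.
    by rewrite addr_ge0// sumr_ge0// => k _; rewrite sumr_ge0.
  have := @segment_compact R (-1) 1; rewrite compact_ultra.
  move=> /(_ (fmap (fun n => c n i j) U) (ultra_fmap _ UU) cI)[l [_ hl]]; by exists l.
move=> /choice[l' hl'].
pose l : 'M[R]_m.+1 := \matrix_(i, j) l' (i, j).
have hl i j : c n i j @[n --> U] --> l i j by rewrite mxE; exact: (hl' (i, j)).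
have le_lim (f g f' g' : nat -> R) (a b a' b' : R) :
    f @ U --> a -> g @ U --> b -> f' @ U --> a' -> g' @ U --> b' ->
    (forall n, eval2 (c n) (f n) (g n) <= eval2 (c n) (f' n) (g' n)) ->
    eval2 l a b <= eval2 l a' b'.
  move=> fa gb fa' gb' le; have := ler_cvg_to (cvg_eval2 hl fa gb) (cvg_eval2 hl fa' gb').
  by apply; exact: filterE.
have cstU (a : R) : cst a @ U --> a by exact: cvg_cst.
(* The absolute values of the coefficients sum to 1 for every [n], hence also in the limit, which
   excludes [l = 0]. *)
suff l0 : l = 0.
  have := @cvg_sum_norm R m U FU c l hl.
  have -> : (fun n => \sum_(i < m.+1) \sum_(j < m.+1) `|c n i j|) = cst 1.
    by apply/funext => n; have [-> _ _ _] := hc n.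
  have -> : \sum_(i < m.+1) \sum_(j < m.+1) `|l i j| = 0.
    by rewrite l0 big1// => i _; apply: big1 => j _; rewrite mxE normr0.
  move=> h; have E : 1 = 0 :> R :=
    @cvg_unique _ (@Rhausdorff R) _ (fmap_proper_filter _ PU) _ _ (cstU 1) h.
  by have /eqP/(_ E) := oner_neq0 R.
have expN s : 0 < s <= 1 -> exists2 t : R, 0 <= t & expR (- t) = s.
  move=> /andP[s0 s1]; exists (- ln s); first by rewrite oppr_ge0 ln_le0.
  by rewrite opprK lnK.
apply: flow_invariant_eq0.
- move=> a b.
  have pos s : 0 < s <= 1 -> eval2 l (b + (a - b) * s) b <= eval2 l a b.
    move=> /expN[t t0 <-].
    apply: (le_lim (fun n => exp2 (e n) b (a - b) t) (fun n => exp2 (e n) b 0 t)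
      (cst a) (cst b)) => //.
    + exact: cvg_exp2.
    + by have := @cvg_exp2 R U FU e b 0 t eU; rewrite mul0r addr0.
    + by move=> n; have [_ _ + _] := hc n; exact.
  (* The value [s = 0] is no exponential; it is reached by continuity through [s = e n]. *)
  move=> s /andP[]; rewrite le_eqVlt => /predU1P[<- _|s0 s1]; last first.
    by apply: pos; rewrite s0.
  apply: (ler_cvg_to (f := fun n => eval2 l (b + (a - b) * e n) b)
    (g := fun=> eval2 l a b) (a := U)).
  + apply: cvg_eval2 => [i j||]; [exact: cvg_cst| |exact: cvg_cst].
    by apply: cvgD; [exact: cvg_cst|apply: cvgMr].
  + exact: cvg_cst.
  + by apply: nearW => n; apply: pos; rewrite e_gt0 invf_le1// ler1n.
- move=> a b.
  have pos s : 0 < s <= 1 -> eval2 l a (- a + (a + b) * s) <= eval2 l a b.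
    move=> /expN[t t0 <-].
    apply: (le_lim (fun n => exp2 (e n) a 0 t) (fun n => exp2 (e n) (- a) (a + b) t)
      (cst a) (cst b)) => //.
    + by have := @cvg_exp2 R U FU e a 0 t eU; rewrite mul0r addr0.
    + exact: cvg_exp2.
    + by move=> n; have [_ _ _] := hc n; exact.
  move=> s /andP[]; rewrite le_eqVlt => /predU1P[<- _|s0 s1]; last first.
    by apply: pos; rewrite s0.
  apply: (ler_cvg_to (f := fun n => eval2 l a (- a + (a + b) * e n))
    (g := fun=> eval2 l a b) (a := U)).
  + apply: cvg_eval2 => [i j||]; [exact: cvg_cst|exact: cvg_cst|].
    by apply: cvgD; [exact: cvg_cst|apply: cvgMr].
  + exact: cvg_cst.
  + by apply: nearW => n; apply: pos; rewrite e_gt0 invf_le1// ler1n.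
- apply: (@cvg_unique _ (@Rhausdorff R) _ (fmap_proper_filter _ PU) _ _
    (cvg_eval2 hl (cstU 0) (cstU 0))).
  have -> : (fun n => eval2 (c n) (cst 0 n) (cst 0 n)) = cst 0.
    by apply/funext => n; have [_ -> _ _] := hc n.
  exact: cstU.
Qed.
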